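(* Suppose $\theta:=\mathbf{b}/\mathbf{a}$ is irrational, with continued fraction convergents $p_n/q_n=p_n(\theta)/q_n(\theta)$, and let $\mu>0$. Let $$\mathcal{A}_h:=\Big\{q_n(\theta)\,:\,q_n(\theta)\in\big[h^{\min(\delta_1',\delta_2')-1-\mu},\,h^{1-2\min(\delta_1,\delta_2)+\mu}\big]\Big\},\qquad \tau_n^{*}:=\frac{\mathbf{a}q_n+\mathbf{b}p_n}{\mathbf{a}^2+\mathbf{b}^2}.$$ Then, over those $h$ (tending to $0^+$) for which $\mathcal{A}_h\neq\emptyset$, $$\sup_{n\in\{m\in\mathbb{N}:\,q_m(\theta)\in\mathcal{A}_h\}}\big|\mathbf{a_1}(\tau_n^{*})-1\big|=O(h^\mu).$$
   Context: Setting. Fix $\omega_1,\omega_2>0$, a polynomial $F\in\mathbb{R}[X,Y]$ not depending on $h$, a point $(E_1,E_2)\in\,]0,1]^2$, exponents $0<\delta_i<\delta_i'<1$ ($i=1,2$) and a nonnegative, not identically zero function $\chi\in\mathcal{S}(\mathbb{R}^2)$. $h>0$ is a small parameter. For integers $n,m$ put $\tau_n:=\omega_1h(n+\tfrac12)$, $\mu_m:=\omega_2h(m+\tfrac12)$. Let $n_0=n_0(h)$ (resp. $m_0=m_0(h)$) be the integer in $\mathbb{N}=\{0,1,2,\dots\}$ minimizing $|\tau_n-E_1|$ (resp. $|\mu_m-E_2|$), assumed unique. For $(n,m)\in\mathbb{Z}^2$ put $$a_{n,m}:=K_h\,\chi\Big(\frac{\tau_n-\tau_{n_0}}{h^{\delta_1'}},\frac{\mu_m-\mu_{m_0}}{h^{\delta_2'}}\Big),\qquad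 K_h:=\Big\|\chi\Big(\frac{\tau_n-\tau_{n_0}}{h^{\delta_1'}},\frac{\mu_m-\mu_{m_0}}{h^{\delta_2'}}\Big)\Big\|_{\ell^2(\mathbb{N}^2)}^{-1},$$ so that $\sum_{n,m\in\mathbb{N}}|a_{n,m}|^2=1$ ($h$ small enough). Assume $\frac{\partial F}{\partial X}(E_1,E_2)\neq0$ and $\frac{\partial F}{\partial Y}(E_1,E_2)\neq0$. Put $T_{cl_1}:=\frac{2\pi}{\omega_1\frac{\partial F}{\partial X}(E_1,E_2)}$, $T_{cl_2}:=\frac{2\pi}{\omega_2\frac{\partial F}{\partial Y}(E_1,E_2)}$ and $$\mathbf{a_1}(t):=\sum_{(n,m)\in\mathbb{N}^2}|a_{n,m}|^2e^{-2i\pi t\left(\frac{n-n_0}{T_{cl_1}}+\frac{m-m_0}{T_{cl_2}}\right)}.$$ Put $\mathbf{a}:=1/|T_{cl_1}|$, $\mathbf{b}:=1/|T_{cl_2}|$. The convergents $p_n/q_n=[a_0,a_1,\dots,a_n]$ of the continued fraction expansion $\theta=[a_0,a_1,\dots]$ satisfy $|\theta-p_n/q_n|\leq 1/q_n^2$. *)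

(* Defs.v *)
From HB Require Import structures.
From mathcomp Require Import all_boot all_order all_algebra finmap.
From mathcomp Require Import all_classical all_reals all_analysis summability.
From mathcomp Require Import complex polyXY.

Set Implicit Arguments.
Unset Strict Implicit.
Unset Printing Implicit Defensive.

Import Order.TTheory GRing.Theory Num.Theory.
Import numFieldNormedType.Exports.

Local Open Scope classical_set_scope.
Local Open Scope ring_scope.

(* [pderiv w f] is the iterated partial derivative of f along the word w, where
   [true] stands for the first variable and [false] for the second one.       *)
Definition pderiv (R : realType) (w : seq bool) (f : R * R -> R) : R * R -> R :=
  foldr (fun b (g : R * R -> R) => 'D_(if b then (1, 0) else (0, 1)) g) f w.

(* The class S(R^2), for real-valued functions.  Frechet differentiability of
   the partial derivatives of all orders is the same as f being C^oo.         *)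
Definition schwartz (R : realType) (f : R * R -> R) : Prop :=
  forall w : seq bool,
    (forall z : R * R, differentiable (pderiv w f) z) /\
    (forall j k : nat, exists C : R, forall z : R * R,
       `|z.1 ^+ j * z.2 ^+ k * pderiv w f z| <= C).

(* In [{poly {poly R}}] the outer variable is X and the inner one is Y, and
   [F.[x, y]] is the value of F at X = x, Y = y.                              *)
Definition dX (R : realType) (F : {poly {poly R}}) : {poly {poly R}} := F^`().
Definition dY (R : realType) (F : {poly {poly R}}) : {poly {poly R}} :=
  map_poly (@deriv R) F.

(* The eigenvalues tau_n (omega = omega_1) and mu_m (omega = omega_2). *)
Definition level (R : realType) (omega h : R) (n : int) : R :=
  omega * h * (n%:~R + 2^-1).

Definition unique_nearest (R : realType) (omega E h : R) (n0 : nat) : Prop :=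
  forall n : nat, n <> n0 ->
    `|level omega h (n0 : int) - E| < `|level omega h (n : int) - E|.

(* Here and in [a1] below, [sum] is the unordered sum: the limit of the sums
   over the finite subsets of the index set.                                  *)
Definition l2norm (R : realType) (I : choiceType) (u : I -> R) : R :=
  Num.sqrt (sum (fun i => `|u i| ^+ 2 : R^o)).

Definition profile (R : realType) (chi : R * R -> R)
    (omega1 omega2 delta1' delta2' h : R) (n0 m0 : nat) (n m : int) : R :=
  chi ((level omega1 h n - level omega1 h (n0 : int)) / h `^ delta1',
       (level omega2 h m - level omega2 h (m0 : int)) / h `^ delta2').

Definition coef (R : realType) (chi : R * R -> R)
    (omega1 omega2 delta1' delta2' h : R) (n0 m0 : nat) (n m : int) : R :=
  let u := profile chi omega1 omega2 delta1' delta2' h n0 m0 in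
  (l2norm (fun i : nat * nat => u (i.1 : int) (i.2 : int)))^-1 * u n m.

Definition expi (R : realType) (x : R) : R[i] := (cos x +i* sin x)%C.

Definition Tcl1 (R : realType) (omega1 : R) (F : {poly {poly R}}) (E1 E2 : R) : R :=
  2 * pi / (omega1 * (dX F).[E1, E2]).
Definition Tcl2 (R : realType) (omega2 : R) (F : {poly {poly R}}) (E1 E2 : R) : R :=
  2 * pi / (omega2 * (dY F).[E1, E2]).

Definition a1 (R : realType) (chi : R * R -> R)
    (omega1 omega2 delta1' delta2' : R) (T1 T2 : R)
    (h : R) (n0 m0 : nat) (t : R) : R[i] :=
  sum (fun i : nat * nat =>
    (`|coef chi omega1 omega2 delta1' delta2' h n0 m0 (i.1 : int) (i.2 : int)|
       ^+ 2)%:C%C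
    * expi (- 2 * pi * t * ((i.1%:R - n0%:R) / T1 + (i.2%:R - m0%:R) / T2))
    : R[i]^o).

(* Complete quotients and partial quotients of the continued fraction of theta,
   for theta irrational.                                                      *)
Fixpoint cf_complete (R : realType) (theta : R) (n : nat) : R :=
  if n is n'.+1 then
    (cf_complete theta n' - (Num.floor (cf_complete theta n'))%:~R)^-1
  else theta.

Definition cf_digit (R : realType) (theta : R) (n : nat) : int :=
  Num.floor (cf_complete theta n).

(* [a_0, a_1, ..., a_n] = a_0 + 1 / (a_1 + 1 / ( ... + 1 / a_n)); the innermost
   step is right because 0^-1 = 0.                                            *)
Definition cf_eval (s : seq int) : rat :=
  foldr (fun (a : int) (r : rat) => a%:~R + r^-1) 0 s.

Definition convergent (R : realType) (theta : R) (n : nat) : rat :=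
  cf_eval [seq cf_digit theta k | k <- iota 0 n.+1].

Definition cf_p (R : realType) (theta : R) (n : nat) : int :=
  numq (convergent theta n).
Definition cf_q (R : realType) (theta : R) (n : nat) : int :=
  denq (convergent theta n).

Definition Aset (R : realType) (theta delta1 delta2 delta1' delta2' mu h : R) :
    set int :=
  [set q | (exists n : nat, q = cf_q theta n) /\
     h `^ (Num.min delta1' delta2' - 1 - mu) <= q%:~R
       <= h `^ (1 - 2 * Num.min delta1 delta2 + mu)].

Definition tau_star (R : realType) (a b : R) (n : nat) : R :=
  (a * (cf_q (b / a) n)%:~R + b * (cf_p (b / a) n)%:~R) / (a ^+ 2 + b ^+ 2).

(* Main.v *)
(* The weights |a_{n,m}|^2 add up to 1, and tau := tau_n^* is chosen so that tau a
   and tau b are both within 1/q of integers, because |q theta - p| <= 1/q.  By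
   periodicity the (n,m) term of a_1(tau) - 1 is therefore at most
   |a_{n,m}|^2 (4 pi / q) (|n - n_0| + |m - m_0|).  Comparing sums over the grid
   of mesh omega_i h^(1 - delta_i') with integrals of the rapidly decreasing chi,
   the mean of |n - n_0| + |m - m_0| is O(h^(min(delta_1', delta_2') - 1)), and
   the lower bound on q in the definition of A_h turns this into O(h^mu).  *)
Require Import Defs.
From HB Require Import structures.
From mathcomp Require Import all_boot all_order all_algebra finmap.
From mathcomp Require Import all_classical all_reals all_analysis summability.
From mathcomp Require Import complex polyXY.
From mathcomp Require Import ring lra zify.

Set Implicit Arguments.
Unset Strict Implicit.
Unset Printing Implicit Defensive.

Import Order.TTheory GRing.Theory Num.Theory.
Import numFieldNormedType.Exports.

Local Open Scope classical_set_scope.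
Local Open Scope ring_scope.

(** * Continued fractions and the approximation quality of convergents *)

Section ContinuedFractions.
Variable R : realType.
Implicit Types (s : seq int) (y theta : R).

(* [cf_matrix s = (p, p', q, q')] when [y |-> [s, y]] is the homography
   [y |-> (p y + p') / (q y + q')]; the value of [s] itself is the one at
   infinity, [p / q]. *)
Fixpoint cf_matrix s : int * int * int * int :=
  if s is a :: s' then
    let: (p, p', q, q') := cf_matrix s' in (a * p + q, a * p' + q', p, p')
  else (1, 0, 0, 1).

(** Each digit [a] multiplies on the left by the matrix with rows [(a, 1)] and [(1, 0)], of
    determinant -1. *)
Lemma cf_matrix_det s : let: (p, p', q, q') := cf_matrix s in
  p * q' - p' * q = 1 \/ p * q' - p' * q = -1.
Proof.
elim: s => [|a s]/=; first by left.
case: (cf_matrix s) => [[[p p'] q] q'] [e|e]; [right|left]; lia.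
Qed.

Lemma cf_matrix_ge s : all (fun a => 1 <= a) s ->
  let: (p, p', q, q') := cf_matrix s in
  [/\ 1 <= p, 0 <= p', 0 <= q & 0 <= q'].
Proof.
elim: s => //= a s IH /andP[a1 /IH].
case: (cf_matrix s) => [[[p p'] q] q'] [? ? ? ?]; split; nia.
Qed.

Lemma cf_eval_matrix s : all (fun a => 1 <= a) (behead s) ->
  let: (p, _, q, _) := cf_matrix s in cf_eval s = p%:~R / q%:~R.
Proof.
(* The empty word has matrix value 1/0, which is 0 by the convention on inverses, as [cf_eval]
   requires. For a longer word the tail has [p >= 1], so its value can be inverted; the leading
   digit may be any integer. *)
elim: s => [|a s IH] /= s1; first by rewrite invr0 mulr0.
have := IH; have := cf_matrix_ge s1.
case: (cf_matrix s) => [[[p p'] q] q'] [p1 _ _ _] -> /=;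
  last by case: (s) s1 => //= ? ? /andP[].
rewrite invf_div intrD intrM mulrDl mulfK// intr_eq0; lia.
Qed.

Lemma cf_tail_matrix s y : all (fun a => 1 <= a) (behead s) -> 0 < y ->
  let: (p, p', q, q') := cf_matrix s in
  foldr (fun (a : int) r => a%:~R + r^-1) y s
    = (p%:~R * y + p'%:~R) / (q%:~R * y + q'%:~R).
Proof.
elim: s => [|a s IH] /= s1 y0; first by rewrite mul1r mul0r addr0 add0r divr1.
have := IH; have := cf_matrix_ge s1.
case: (cf_matrix s) => [[[p p'] q] q'] [p1 p'0 _ _] -> //=;
  last by case: (s) s1 => //= ? ? /andP[].
have py : p%:~R * y + p'%:~R != 0 :> R.
  by rewrite gt_eqF// ltr_wpDr ?ler0z// mulr_gt0 ?ltr0z//; lia.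
rewrite invf_div !intrD !intrM; field; exact: py.
Qed.

Lemma irrational_cf_complete theta n :
  irrational theta -> irrational (cf_complete theta n).
Proof.
move=> irr; elim: n => //= n IH [r _ e]; apply: IH.
set x := cf_complete theta n in e *.
exists (r^-1 + (Num.floor x)%:~R) => //.
by rewrite rmorphD/= fmorphV/= e invrK ratr_int subrK.
Qed.

Lemma cf_complete_gt1 theta n : irrational theta -> 1 < cf_complete theta n.+1.
Proof.
move=> irr /=; have := @irrational_cf_complete theta n irr.
set x := cf_complete theta n => irrx.
have /andP[fx xf] := floor_itv x.
rewrite invf_gt1 ?subr_gt0; last first.
  rewrite lt_neqAle fx andbT; apply/eqP => e; apply: irrx.
  by exists (Num.floor x)%:~R => //; rewrite ratr_int.
by rewrite ltrBlDl -[1]/(1%:~R) -intrD.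
Qed.

Lemma cf_digit_ge1 theta n : irrational theta -> 1 <= cf_digit theta n.+1.
Proof.
by move=> irr; rewrite floor_ge_int ltW//; exact: cf_complete_gt1.
Qed.

(** Complete quotients satisfy x_n = a_n + 1 / x_(n+1), so replacing the innermost entry x_n
    lengthens the word without changing its value. *)
Lemma cf_digitsK theta n :
  foldr (fun (a : int) r => a%:~R + r^-1) (cf_complete theta n)
    [seq cf_digit theta k | k <- iota 0 n] = theta.
Proof.
elim: n => // n IH; have -> : iota 0 n.+1 = rcons (iota 0 n) n.
  by rewrite -addn1 iotaD cats1.
by rewrite map_rcons foldr_rcons /= invrK addrC subrK.
Qed.

(** With y the next complete quotient, theta = (p y + p') / (q y + q'). Hence q theta - p is the
    determinant, up to sign, divided by q y + q', and q y + q' >= q because y > 1. *)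
Lemma convergent_dist theta n : irrational theta ->
  `|theta * (cf_q theta n)%:~R - (cf_p theta n)%:~R|
    <= (cf_q theta n)%:~R^-1.
Proof.
move=> irr; set s := [seq cf_digit theta k | k <- iota 0 n.+1].
have s1 : all (fun a => 1 <= a) (behead s).
  rewrite /s /= all_map; apply/allP => k; rewrite mem_iota => /andP[k0 _] /=.
  by rewrite -(prednK k0) cf_digit_ge1.
have y1 := cf_complete_gt1 n irr.
have y0 : 0 < cf_complete theta n.+1 by rewrite (lt_trans _ y1).
have := cf_tail_matrix s1 y0; have := cf_eval_matrix s1.
rewrite /cf_p /cf_q /convergent -/s cf_digitsK.
(* The word is nonempty, so its [q] is the [p] of its tail, whose digits are all at least 1. *)
have : let: (_, _, q, q') := cf_matrix s in 1 <= q /\ 0 <= q'.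
  have := cf_matrix_ge s1; rewrite /s /=.
  by case: (cf_matrix _) => [[[p p'] q] q'] [].
have := cf_matrix_det s; case: (cf_matrix s) => [[[p p'] q] q'] det [q1 q'0] ->.
(* The determinant identity is a Bezout relation, so [p] and [q] are the reduced numerator and
   denominator that define [cf_p] and [cf_q]. *)
have cop : coprime `|p| `|q|.
  by rewrite -coprimezE; apply/coprimezP; case: det => e;
    [exists (q', - p')|exists (- q', p')] => /=; lia.
have q0 : 0 < q by lia.
rewrite (coprimeq_num cop) (coprimeq_den cop) gtr0_sg// mul1r gt_eqF// (gtr0_norm q0).
set y := cf_complete _ _ => thetaE.
have qr : 0 < q%:~R :> R by rewrite ltr0z.
have D0 : 0 < q%:~R * y + q'%:~R by rewrite ltr_wpDr ?ler0z ?mulr_gt0.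
have -> : theta * q%:~R - p%:~R = (p' * q - p * q')%:~R / (q%:~R * y + q'%:~R).
  by rewrite [theta]thetaE intrB !intrM; field; rewrite gt_eqF.
have -> : `|(p' * q - p * q')%:~R / (q%:~R * y + q'%:~R)| = (q%:~R * y + q'%:~R)^-1 :> R.
  rewrite normrM normfV (gtr0_norm D0) (_ : `|_%:~R| = 1) ?mul1r//.
  have [->|->] : p' * q - p * q' = 1 \/ p' * q - p * q' = -1 by lia.
    by rewrite normr1.
  by rewrite intrN normrN normr1.
by rewrite lef_pV2 ?posrE// ler_wpDr ?ler0z// ler_peMr ?(ltW qr) ?(ltW y1).
Qed.

End ContinuedFractions.

(* Convergence of unordered sums *)
#[local] Existing Instance totally_filter.

Section UnorderedSums.
Variable I : choiceType.
Implicit Types A B : {fset I}.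

Lemma totallyP (P : set {fset I}) :
  (exists A, forall B, (A `<=` B)%fset -> P B) -> totally P.
Proof. by move=> [A AP]; exists A => //= B /AP. Qed.

Lemma partial_sumE (V : zmodType) (x : I -> V) A :
  partial_sum x A = \sum_(i <- A) x i.
Proof. by rewrite /partial_sum big_seq_fsetE. Qed.

Lemma eq_sum (K : numDomainType) (V : normedModType K)
  (x y : I -> V) : x =1 y -> sum x = sum y.
Proof. by move=> /funext ->. Qed.

Lemma ler_partial_sum (R : realType) (x y : I -> R) A :
  (forall i, x i <= y i) -> partial_sum x A <= partial_sum y A.
Proof. by move=> xy; apply: ler_sum => i _; exact: xy. Qed.

Lemma ler_sum_uniq_subset (R : numDomainType) (x : I -> R) (s1 s2 : seq I) :
  (forall i, 0 <= x i) -> uniq s1 -> uniq s2 -> {subset s1 <= s2} ->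
  \sum_(i <- s1) x i <= \sum_(i <- s2) x i.
Proof.
move=> x0 u1 u2 s12; rewrite [leRHS](bigID (mem s1))/= -[X in _ <= X + _]big_filter.
have s12E : perm_eq s1 [seq i <- s2 | i \in s1].
  apply: uniq_perm => //; first exact: filter_uniq.
  by move=> i; rewrite mem_filter; case: (boolP (i \in s1)) => // /s12 ->.
by rewrite (perm_big _ s12E) lerDl sumr_ge0.
Qed.

Lemma nondecreasing_partial_sum (R : realType) (x : I -> R) A B :
  (forall i, 0 <= x i) -> (A `<=` B)%fset -> partial_sum x A <= partial_sum x B.
Proof.
move=> x0 AB; rewrite !partial_sumE ler_sum_uniq_subset//.
exact: fsubsetP.
Qed.

(** The partial sums increase with the finite set, so they converge to their supremum. *)
Lemma cvg_sum_ge0 (R : realType) (x : I -> R) (M : R) :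
  (forall i, 0 <= x i) -> (forall A, partial_sum x A <= M) ->
  cvg (partial_sum (x : I -> R^o) @ totally).
Proof.
move=> x0 xM; pose S := range (partial_sum x).
have supS : has_sup S.
  split; first by exists (partial_sum x fset0); exists fset0.
  by exists M => _ [A _ <-].
apply/cvg_ex; exists (sup S); apply/cvgrPdist_le => e e0.
have [_ [A _ <-] SA] := sup_adherent e0 supS.
apply: totallyP; exists A => B AB.
have BS : partial_sum x B <= sup S by apply: ub_le_sup; [case: supS|exists B].
have := nondecreasing_partial_sum x0 AB.
by move=> AB'; rewrite ger0_norm ?subr_ge0//; move: SA AB' BS; lra.
Qed.

Lemma partial_sum_le_sum (R : realType) (x : I -> R) (M : R) A :
  (forall i, 0 <= x i) -> (forall A, partial_sum x A <= M) ->
  partial_sum x A <= sum (x : I -> R^o).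
Proof.
move=> x0 xM; have cx := cvg_sum_ge0 x0 xM.
rewrite /sum; apply: limr_ge => //; apply: totallyP; exists A => B AB.
exact: nondecreasing_partial_sum.
Qed.

(** Write x as (x + y) - y: both families are nonnegative with bounded partial sums. *)
Lemma cvg_sum_abs (R : realType) (x y : I -> R) (M : R) :
  (forall i, `|x i| <= y i) -> (forall A, partial_sum y A <= M) ->
  cvg (partial_sum (x : I -> R^o) @ totally).
Proof.
move=> xy yM.
have y0 i : 0 <= y i by rewrite (le_trans _ (xy i)).
have cy := cvg_sum_ge0 y0 yM.
have cxy : cvg (partial_sum ((fun i => x i + y i) : I -> R^o) @ totally).
  apply: (@cvg_sum_ge0 _ _ (M + M)) => [i|A].
    by have := xy i; rewrite ler_norml; lra.
  rewrite (@le_trans _ _ (partial_sum (fun i => y i + y i) A))//.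
    by apply: ler_partial_sum => i; have := xy i; rewrite ler_norml; lra.
  by rewrite /partial_sum big_split/= lerD// -/(partial_sum _ _).
have -> : partial_sum (x : I -> R^o) =
    partial_sum ((fun i => x i + y i) : I -> R^o) \- partial_sum (y : I -> R^o).
  by apply/funext => A; rewrite /= /partial_sum big_split/= addrK.
exact: is_cvgB.
Qed.

Lemma cvg_complex (T : Type) (G : set_system T) (FG : Filter G) (R : realType)
    (f : T -> R[i]) (r s : R) :
  (fun t => complex.Re (f t) : R^o) @ G --> (r : R^o) ->
  (fun t => complex.Im (f t) : R^o) @ G --> (s : R^o) ->
  (f : T -> R[i]^o) @ G --> ((r +i* s)%C : R[i]^o).
Proof.
move=> fr fs; apply/cvgrPdist_le => /= e e0.
(* The norm on [R[i]] is complex-valued, and a positive complex number is real. *)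
have [e' e'0 ->] : exists2 e' : R, 0 < e' & e = e'%:C%C.
  move: e0; case: e => a b; rewrite ltcE/= => /andP[/eqP b0 a0].
  by exists a => //; rewrite b0.
have e2 : 0 < e' / 2 by rewrite divr_gt0.
move/cvgrPdist_le : fr => /(_ _ e2); move/cvgrPdist_le : fs => /(_ _ e2).
move=> H1 H2; near=> t.
have h1 : `|s - complex.Im (f t)| <= e' / 2 by near: t.
have h2 : `|r - complex.Re (f t)| <= e' / 2 by near: t.
rewrite [_ - f t](_ : _ = (r - complex.Re (f t))%:C%C +
  'i%C * (s - complex.Im (f t))%:C%C); last first.
  by case: (f t) => a b; simpc.
rewrite (le_trans (ler_normD _ _))// normrM !normc_def /=.
rewrite !expr0n !addr0 !add0r expr1n sqrtr1 mul1r -rmorphD /= lecR.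
by rewrite !sqrtr_sqr; lra.
Unshelve. all: end_near. Qed.

(** Since [sum] is a limit, the series defining [a1] can be estimated only once its convergence is
    known; domination passes to real and imaginary parts. *)
Lemma cvg_sum_complex (R : realType) (x : I -> R[i]) (y : I -> R) (M : R) :
  (forall i, Normc.normc (x i) <= y i) -> (forall A, partial_sum y A <= M) ->
  cvg (partial_sum (x : I -> R[i]^o) @ totally).
Proof.
move=> xy yM.
have cRe : cvg (partial_sum ((fun i => complex.Re (x i)) : I -> R^o) @ totally).
  apply: (@cvg_sum_abs _ _ y M) => // i; rewrite (le_trans _ (xy i))//.
  by case: (x i) => a b /=; rewrite -[leLHS]sqrtr_sqr ler_wsqrtr// lerDl sqr_ge0.
have cIm : cvg (partial_sum ((fun i => complex.Im (x i)) : I -> R^o) @ totally).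
  apply: (@cvg_sum_abs _ _ y M) => // i; rewrite (le_trans _ (xy i))//.
  by case: (x i) => a b /=; rewrite -[leLHS]sqrtr_sqr ler_wsqrtr// lerDr sqr_ge0.
case/cvg_ex : cRe => r xr; case/cvg_ex : cIm => s xs.
apply/cvg_ex; exists (r +i* s)%C; apply: cvg_complex.
  rewrite (_ : (fun _ => _) = partial_sum ((fun i => complex.Re (x i)) : I -> R^o))//.
  by apply/funext => A; rewrite /partial_sum raddf_sum.
rewrite (_ : (fun _ => _) = partial_sum ((fun i => complex.Im (x i)) : I -> R^o))//.
by apply/funext => A; rewrite /partial_sum raddf_sum.
Qed.

End UnorderedSums.

(** * The unit phase: Lipschitz bound and periodicity *)

Section Expi.
Variable R : realType.
Implicit Types x y : R.

Lemma lipschitz_origin (f df : R -> R) x :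
  (forall y, is_derive y 1 f (df y)) -> (forall y, `|df y| <= 1) ->
  `|f x - f 0| <= `|x|.
Proof.
move=> fdf df1.
have fc (a b : R) : {within `[a, b], continuous f}.
  apply: continuous_subspaceT => y; apply: differentiable_continuous.
  by apply/derivable1_diffP; case: (fdf y).
have [x0|x0] := leP 0 x.
  have [c _ ->] := MVT_segment x0 (fun y _ => fdf y) (fc 0 x).
  by rewrite subr0 normrM ler_piMl.
have [c _] := MVT_segment (ltW x0) (fun y _ => fdf y) (fc x 0).
by rewrite distrC => ->; rewrite sub0r normrM normrN ler_piMl.
Qed.

(** The modulus is at most the sum of the absolute values of the real and imaginary parts, each
    bounded by |x| through the mean value theorem; whence the factor 2. *)
Lemma normc_expi_sub1 x : Normc.normc (expi x - 1) <= 2 * `|x|.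
Proof.
have sx : `|sin x| <= `|x|.
  have := @lipschitz_origin (@sin R) (@cos R) x (fun y => is_derive_sin y) (@cos_max R).
  by rewrite sin0 subr0.
have cx : `|cos x - 1| <= `|x|.
  have := @lipschitz_origin (@cos R) (fun y => - sin y) x (fun y => is_derive_cos y).
  by rewrite cos0; apply => y; rewrite normrN sin_max.
have n0 : 0 <= `|cos x - 1| + `|sin x| by rewrite addr_ge0.
rewrite /expi /= oppr0 addr0 (@le_trans _ _ (`|cos x - 1| + `|sin x|))//; last lra.
rewrite -[leRHS](ger0_norm n0) -sqrtr_sqr ler_wsqrtr//.
rewrite [leRHS]sqrrD !real_normK ?num_real// lerD2r lerDl.
by rewrite mulrn_wge0// mulr_ge0.
Qed.

Lemma normc_expi x : Normc.normc (expi x) = 1.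
Proof. by rewrite /= cos2Dsin2 sqrtr1. Qed.

Lemma expiD_int x (k : int) : expi (x + 2 * pi * k%:~R) = expi x.
Proof.
have H y (n : nat) : expi (y + 2 * pi * n%:R) = expi y.
  have -> : 2 * pi * n%:R = pi *+ 2 *+ n :> R by rewrite mulr_natr mulr_natl.
  by rewrite /expi (periodicn (@cosD2pi R)) (periodicn (@sinD2pi R)).
case: k => n; first exact: H.
(* For a negative multiple, the natural-number case is applied at the shifted point. *)
by rewrite NegzE -[LHS](H _ n.+1) mulrNz -pmulrn; congr expi; ring.
Qed.

End Expi.

(** * One-dimensional sums over a grid of mesh eps *)

Section RiemannSums.
Variable R : realType.
Implicit Types (x eps r z : R).

(** The exponent 2 makes grid sums O(1/eps), and a second power of [decay] can absorb a factor
    |x|. *)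
Definition decay x : R := (1 + `|x|) ^- 2.

Lemma decay_ge0 x : 0 <= decay x.
Proof. by rewrite invr_ge0 sqr_ge0. Qed.

Lemma ler_norm_decay x : `|x| * decay x ^+ 2 <= decay x.
Proof.
rewrite expr2 mulrA -[leRHS]mul1r ler_wpM2r ?decay_ge0//.
rewrite /decay ler_pdivrMr ?mul1r; last by rewrite exprn_gt0// ltr_wpDr.
by have := normr_ge0 x; nra.
Qed.

Lemma decay_le1 x : decay x <= 1.
Proof.
by rewrite /decay invf_le1 ?exprn_gt0// ?ltr_wpDr// exprn_ege1// lerDl.
Qed.

Lemma decay_sqr_le x : decay x ^+ 2 <= decay x.
Proof. by rewrite expr2 ler_piMr ?decay_ge0 ?decay_le1. Qed.

(* [x / (1 + |x|)] is a bounded primitive of [decay], so sums of [decay] telescope. *)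
Lemma decay_le_diff x eps : 0 < eps <= 1 -> 0 <= x \/ x + eps <= 0 ->
  decay x <= 2 / eps * ((x + eps) / (1 + `|x + eps|) - x / (1 + `|x|)).
Proof.
move=> /andP[e0 e1] [x0|x0]; rewrite /decay.
  have xe0 : 0 <= x + eps by lra.
  rewrite !ger0_norm// [leRHS](_ : _ = 2 / ((1 + x) * (1 + (x + eps)))); last first.
    by field; rewrite !gt_eqF//; lra.
  by rewrite ler_pdivlMr ?mulr_gt0//; [rewrite mulrC ler_pdivrMr ?exprn_gt0//; nra|lra|lra].
have x0' : x <= 0 by lra.
rewrite !ler0_norm// [leRHS](_ : _ = 2 / ((1 - x) * (1 - (x + eps)))); last first.
  by field; rewrite !gt_eqF//; lra.
by rewrite ler_pdivlMr ?mulr_gt0//; [rewrite mulrC ler_pdivrMr ?exprn_gt0//; nra|lra|lra].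
Qed.

(** The primitive takes values in [-1, 1], so its telescoped increments total at most 2, and the
    factor 2/eps gives 4/eps. *)
Lemma sum_decay_le eps (c N : nat) : 0 < eps <= 1 ->
  \sum_(n <- iota 0 N) decay (eps * (n%:R - c%:R)) <= 4 / eps.
Proof.
move=> e01; have /andP[e0 e1] := e01.
pose G x := x / (1 + `|x|).
have G1 x : `|G x| <= 1.
  rewrite normrM normfV ler_pdivrMr; first by rewrite mul1r [leRHS]ger0_norm ?addr_ge0// lerDr.
  by rewrite normr_gt0 gt_eqF// ltr_wpDr.
suff H : \sum_(n <- iota 0 N) decay (eps * (n%:R - c%:R)) <=
    2 / eps * (G (eps * (N%:R - c%:R)) - G (eps * (0%:R - c%:R))).
  apply: le_trans H _; rewrite [4 / eps](_ : _ = 2 / eps * 2); last by field; rewrite gt_eqF.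
  rewrite ler_wpM2l ?divr_ge0//; first exact: ltW.
  have := G1 (eps * (N%:R - c%:R)); have := G1 (eps * (0%:R - c%:R)).
  by rewrite !ler_norml; lra.
elim: N => [|N IH]; first by rewrite big_nil subrr mulr0.
rewrite -addn1 iotaD big_cat big_seq1 /= add0n.
have := @decay_le_diff (eps * (N%:R - c%:R)) eps e01.
have -> : eps * (N%:R - c%:R) + eps = eps * ((N + 1)%:R - c%:R).
  by rewrite natrD; ring.
(* The grid point of index [c] is the origin, so no cell straddles 0 and [decay_le_diff] applies to
   each. *)
rewrite -/(G _) -/(G _) => /(_ _)/wrap[].
  have [cN|Nc] := leqP c N; [left|right].
    by rewrite mulr_ge0 ?subr_ge0 ?ler_nat// ltW.
  by rewrite mulr_ge0_le0 ?subr_le0 ?ler_nat ?addn1// ltW.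
by move=> H; rewrite (le_trans (lerD IH H))// -mulrDr ler_wpM2l ?divr_ge0//; lra.
Qed.

(** The indices sought fill an interval of length 2r/eps; the second hypothesis keeps its left end
    in the nonnegative range. It contains at least floor(2r/eps) integers, which is at least r/eps
    because r/eps >= 1. *)
Lemma grid_points eps r z (c : nat) : 0 < eps <= r ->
    0 <= c%:R + (z - r) / eps ->
  exists s : seq nat, [/\ uniq s, r / eps <= (size s)%:R &
    forall n, n \in s -> `|eps * (n%:R - c%:R) - z| <= r].
Proof.
move=> /andP[e0 er] c0; have r0 : 0 < r by lra.
set a := c%:R + _ in c0; set k := Num.trunc a; set N := Num.trunc (2 * r / eps).
have /andP[ka ak] : k%:R <= a < k.+1%:R by exact: truncn_itv.
have /andP[NE EN] : N%:R <= 2 * r / eps < N.+1%:R.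
  by apply: truncn_itv; rewrite divr_ge0// ?mulr_ge0// ltW.
have er1 : 1 <= r / eps by rewrite ler_pdivlMr// mul1r.
exists (iota k.+1 N); split; first exact: iota_uniq.
  by rewrite size_iota; move: EN; rewrite -addn1 natrD -mulrA; lra.
move=> n; rewrite mem_iota => /andP[kn nkN].
have an : a < n%:R by rewrite (lt_le_trans ak)// ler_nat.
have na : n%:R <= a + 2 * r / eps.
  by rewrite (le_trans _ (lerD ka NE))// -natrD ler_nat; lia.
have ae : eps * a = eps * c%:R + z - r by rewrite /a; field; rewrite gt_eqF.
clearbody a; move: an na; rewrite -(ltr_pM2l e0) -(ler_pM2l e0) mulrDr ae => an.
rewrite [eps * (2 * r / eps)](_ : _ = 2 * r); last by field; rewrite gt_eqF.
by move=> na; rewrite ler_norml mulrBr; lra.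
Qed.

End RiemannSums.

(** * Two-dimensional sums: total mass and first moment of the weights *)

Section DoubleSums.
Variable R : realType.

(** A finite set of pairs lies in a square, over which the sum factors. *)
Lemma partial_sum_mul_le (f g : nat -> R) (M N : R) (A : {fset nat * nat}) :
  (forall n, 0 <= f n) -> (forall n, 0 <= g n) ->
  (forall k, \sum_(n <- iota 0 k) f n <= M) ->
  (forall k, \sum_(n <- iota 0 k) g n <= N) ->
  partial_sum (fun i => f i.1 * g i.2) A <= M * N.
Proof.
move=> f0 g0 fM gN; rewrite partial_sumE.
have [K AK] : exists K, forall i, i \in A -> (i.1 < K)%N && (i.2 < K)%N.
  exists (\max_(i <- A) maxn i.1 i.2).+1 => i iA.
  by rewrite -gtn_max (big_rem i)//= ltnS leq_maxl.
apply: (@le_trans _ _ (\sum_(i <- [seq (i, j) | i <- iota 0 K, j <- iota 0 K])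
    f i.1 * g i.2)).
  apply: ler_sum_uniq_subset => //.
  - by move=> i; rewrite mulr_ge0.
  - by apply: allpairs_uniq; rewrite ?iota_uniq// => -[? ?] [? ?] _ _ [-> ->].
  - move=> [i j] /AK /andP[iK jK]; apply/allpairsPdep; exists i, j.
    by rewrite !mem_iota.
by rewrite big_allpairs/= -big_distrlr/= ler_pM// sumr_ge0.
Qed.

Variables (chi : R * R -> R) (C c r x0 y0 : R).
Hypothesis chi_ge0 : forall z, 0 <= chi z.
Hypothesis chi_le : forall z, chi z <= C * (decay z.1 * decay z.2).
Hypotheses (c_gt0 : 0 < c) (r_gt0 : 0 < r).
Hypothesis chi_ge : forall x y, `|x - x0| <= r -> `|y - y0| <= r -> c <= chi (x, y).

Variables (eps1 eps2 : R) (n0 m0 : nat).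
Hypotheses (eps1_gt0 : 0 < eps1) (eps2_gt0 : 0 < eps2).
Hypotheses (eps1_le1 : eps1 <= 1) (eps2_le1 : eps2 <= 1).

Let d1 (n : nat) : R := decay (eps1 * (n%:R - n0%:R)).
Let d2 (m : nat) : R := decay (eps2 * (m%:R - m0%:R)).
(** The weights |a_{n,m}|^2 before normalization; [eps1] and [eps2] will be omega_i h^(1 -
    delta_i'). *)
Let u (i : nat * nat) : R :=
  chi (eps1 * (i.1%:R - n0%:R), eps2 * (i.2%:R - m0%:R)) ^+ 2.

Lemma sqr_profile_le (i : nat * nat) : u i <= C ^+ 2 *
  (d1 i.1 ^+ 2 * d2 i.2 ^+ 2).
Proof.
have h := chi_le (eps1 * (i.1%:R - n0%:R), eps2 * (i.2%:R - m0%:R)).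
by rewrite -!exprMn lerXn2r ?nnegrE//; exact: le_trans h.
Qed.

Let decay_sum M (f g : nat -> R) A :
  0 <= M ->
  (forall n, f n <= d1 n) ->
  (forall n, g n <= d2 n) ->
  (forall n, 0 <= f n) -> (forall n, 0 <= g n) ->
  partial_sum (fun i => M * (f i.1 * g i.2)) A <= M * (16 / (eps1 * eps2)).
Proof.
move=> M0 fd gd f0 g0; rewrite /partial_sum -mulr_sumr ler_wpM2l//.
rewrite [_ / _](_ : _ = 4 / eps1 * (4 / eps2)); last first.
  by field; rewrite !gt_eqF.
apply: partial_sum_mul_le => // k.
  by apply: le_trans (sum_decay_le n0 k _); [exact: ler_sum|exact/andP].
by apply: le_trans (sum_decay_le m0 k _); [exact: ler_sum|exact/andP].
Qed.

Lemma partial_sum_sqr_profile_le A :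
  partial_sum u A <= C ^+ 2 * (16 / (eps1 * eps2)).
Proof.
rewrite (le_trans (ler_partial_sum A sqr_profile_le))//.
apply: (@decay_sum _ (fun n => d1 n ^+ 2) (fun m => d2 m ^+ 2)) => *;
  by rewrite ?sqr_ge0// decay_sqr_le.
Qed.

(* The factor [|n - n0|] costs [1 / eps1], since [eps1 |n - n0|] is absorbed by
   one power of [decay]. *)
Lemma partial_sum_moment_le A :
  partial_sum (fun i => u i * (`|i.1%:R - n0%:R| + `|i.2%:R - m0%:R|)) A
    <= C ^+ 2 * (16 / (eps1 * eps2)) * (eps1^-1 + eps2^-1).
Proof.
have step (e k : R) : 0 < e -> `|k| * decay (e * k) ^+ 2 <= e^-1 * decay (e * k).
  move=> e0; rewrite ler_pdivlMl// mulrA -{1}(gtr0_norm e0) -normrM.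
  exact: ler_norm_decay.
pose v1 (i : nat * nat) := C ^+ 2 / eps1 * (d1 i.1 * d2 i.2 ^+ 2).
pose v2 (i : nat * nat) := C ^+ 2 / eps2 * (d1 i.1 ^+ 2 * d2 i.2).
apply: (@le_trans _ _ (partial_sum (fun i => v1 i + v2 i) A)).
  apply: ler_partial_sum => i; rewrite mulrDr lerD//.
    apply: le_trans (ler_wpM2r _ (sqr_profile_le i)) _ => //; rewrite /v1.
    rewrite [leLHS](_ : _ = C ^+ 2 * d2 i.2 ^+ 2 *
      (`|i.1%:R - n0%:R| * d1 i.1 ^+ 2)); last by ring.
    rewrite [leRHS](_ : _ = C ^+ 2 * d2 i.2 ^+ 2 * (eps1^-1 * d1 i.1)); last by ring.
    by rewrite ler_wpM2l ?step// mulr_ge0 ?sqr_ge0.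
  apply: le_trans (ler_wpM2r _ (sqr_profile_le i)) _ => //; rewrite /v2.
  rewrite [leLHS](_ : _ = C ^+ 2 * d1 i.1 ^+ 2 *
    (`|i.2%:R - m0%:R| * d2 i.2 ^+ 2)); last by ring.
  rewrite [leRHS](_ : _ = C ^+ 2 * d1 i.1 ^+ 2 * (eps2^-1 * d2 i.2)); last by ring.
  by rewrite ler_wpM2l ?step// mulr_ge0 ?sqr_ge0.
rewrite /partial_sum big_split/=.
rewrite [leRHS](_ : _ = C ^+ 2 / eps1 * (16 / (eps1 * eps2)) +
   C ^+ 2 / eps2 * (16 / (eps1 * eps2))); last by field; rewrite !gt_eqF.
have C0 e : 0 < e -> 0 <= C ^+ 2 / e by move=> e0; rewrite divr_ge0 ?sqr_ge0 ?ltW.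
apply: lerD.
  apply: (@decay_sum _ d1 (fun m => d2 m ^+ 2)) => *;
    by rewrite ?C0 ?sqr_ge0 ?decay_ge0 ?decay_sqr_le.
apply: (@decay_sum _ (fun n => d1 n ^+ 2) d2) => *;
  by rewrite ?C0 ?sqr_ge0 ?decay_ge0 ?decay_sqr_le.
Qed.

Hypotheses (eps1_le : eps1 <= r) (eps2_le : eps2 <= r).
Hypotheses (n0_large : 0 <= n0%:R + (x0 - r) / eps1)
  (m0_large : 0 <= m0%:R + (y0 - r) / eps2).

(** At least (r/eps1)(r/eps2) grid points fall in the box where chi >= c, and each contributes at
    least c^2. *)
Lemma sum_sqr_profile_ge :
  (c * r) ^+ 2 / (eps1 * eps2) <= sum (u : nat * nat -> R^o).
Proof.
have [s1 [us1 ss1 hs1]] : exists s : seq nat, _ :=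
  @grid_points R eps1 r x0 n0 ltac:(exact/andP) n0_large.
have [s2 [us2 ss2 hs2]] : exists s : seq nat, _ :=
  @grid_points R eps2 r y0 m0 ltac:(exact/andP) m0_large.
pose A := [fset i in [seq (i, j) | i <- s1, j <- s2]]%fset.
have u0 i : 0 <= u i by rewrite sqr_ge0.
apply: le_trans (partial_sum_le_sum A u0 partial_sum_sqr_profile_le).
rewrite partial_sumE.
apply: (@le_trans _ _ (\sum_(i <- [seq (i, j) | i <- s1, j <- s2]) u i)).
  have -> : (c * r) ^+ 2 / (eps1 * eps2) = r / eps1 * (r / eps2) * c ^+ 2.
    by field; rewrite !gt_eqF.
  apply: (@le_trans _ _ (\sum_(i <- [seq (i, j) | i <- s1, j <- s2]) c ^+ 2)).
    rewrite big_const_seq count_predT iter_addr_0 size_allpairs -mulr_natl natrM.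
    by rewrite ler_wpM2r ?sqr_ge0// ler_pM// divr_ge0// ltW.
  rewrite big_seq [leRHS]big_seq; apply: ler_sum => _ /allpairsPdep[i [j [is1 js2 ->]]].
  rewrite lerXn2r ?nnegrE ?(ltW c_gt0)//.
  by apply: chi_ge; [exact: hs1|exact: hs2].
apply: ler_sum_uniq_subset => //.
- by apply: allpairs_uniq => // -[? ?] [? ?] _ _ [-> ->].
- by move=> i; rewrite !inE.
Qed.

End DoubleSums.

(** The normalized weights w sum to 1, so the difference is the sum of w (e^(i phi) - 1), bounded by
    the w-average of d. *)
Lemma normc_sum_phases_sub1 (I : choiceType) (R : realType) (u d phi : I -> R)
    (M N : R) : (forall i, 0 <= u i) -> (forall A, partial_sum u A <= N) ->
  0 < sum (u : I -> R^o) ->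
  (forall i, Normc.normc (expi (phi i) - 1) <= d i) ->
  (forall A, partial_sum (fun i => u i * d i) A <= M * sum (u : I -> R^o)) ->
  Normc.normc (sum (fun i =>
    (u i / sum (u : I -> R^o))%:C%C * expi (phi i) : R[i]^o) - 1) <= M.
Proof.
move=> u0 uN; set S := sum _ => S0 expid udM.
pose w i := u i / S.
have w0 i : 0 <= w i by rewrite divr_ge0// ltW.
have wN A : partial_sum w A <= N / S.
  by rewrite /partial_sum -mulr_suml ler_pM2r ?invr_gt0//; exact: uN.
pose f i : R[i] := (w i)%:C%C * expi (phi i).
have nf i : Normc.normc (f i) <= w i.
  by rewrite Normc.normcM normc_expi mulr1 /= expr0n addr0 sqrtr_sqr ger0_norm.
have cf := cvg_sum_complex nf wN.
have cw : partial_sum (w : I -> R^o) @ totally --> (1 : R^o).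
  rewrite -[1](@mulfV _ S) ?gt_eqF//.
  rewrite (_ : partial_sum _ = fun A => partial_sum (u : I -> R^o) A * S^-1); last first.
    by apply/funext => A; rewrite /partial_sum -mulr_suml.
  by apply: cvgMl; exact: cvg_sum_ge0 u0 uN.
rewrite -/(sum _) -[sum _]/(sum (f : I -> R[i]^o)).
(* The comparison is made on one finite set [A] where the phase sum and the total weight are both
   within e/2 of their limits. *)
set L := sum _; apply/ler_addgt0Pr => e e0.
have e2 : 0 < e / 2 by rewrite divr_gt0.
have e2C : 0 < (e / 2)%:C%C :> R[i] by rewrite ltcR.
have H1 : \forall A \near totally, `|L - partial_sum f A| <= (e / 2)%:C%C.
  by have /cvgrPdist_le/(_ _ e2C) := cf.
have H2 : \forall A \near totally, `|1 - partial_sum w A| <= e / 2.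
  by have /cvgrPdist_le/(_ _ e2) := cw.
have [A [h1 h2]] := filter_ex (filterI H1 H2).
have h1' : Normc.normc (L - partial_sum f A) <= e / 2.
  by rewrite -lecR; exact: h1.
have h3 : Normc.normc (partial_sum f A - (partial_sum w A)%:C%C) <= M.
  rewrite /partial_sum rmorph_sum/= -sumrB -lecR.
  apply: (@le_trans _ _ (\sum_(i : A) `|f (val i) - (w (val i))%:C%C|)).
    exact: (@ler_norm_sum R[i] R[i]).
  rewrite -[leLHS](rmorph_sum (real_complex R)) lecR.
  have : partial_sum (fun i => u i * d i) A / S <= M by rewrite ler_pdivrMr.
  apply: le_trans; rewrite /partial_sum mulr_suml; apply: ler_sum => i _.
  rewrite /f -{2}[(w _)%:C%C]mulr1 -mulrBr Normc.normcM.
  rewrite [X in X * _](_ : _ = w (val i)); last first.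
    by rewrite /= expr0n addr0 sqrtr_sqr ger0_norm.
  by rewrite [leRHS]mulrAC; apply: ler_wpM2l (w0 _) _ _ (expid _).
have -> : L - 1 = (L - partial_sum f A) +
    ((partial_sum f A - (partial_sum w A)%:C%C) + (partial_sum w A - 1)%:C%C).
  by rewrite rmorphB rmorph1; ring.
apply: le_trans (le_normcD _ _) _; apply: le_trans (lerD (lexx _) (le_normcD _ _)) _.
rewrite [Normc.normc _%:C%C](_ : _ = `|partial_sum w A - 1|); last first.
  by rewrite /= expr0n addr0 sqrtr_sqr.
by rewrite distrC in h2; lra.
Qed.

(** * Upper and lower bounds on the Schwartz profile *)

Section Schwartz.
Variable R : realType.
Variable chi : R * R -> R.
Hypothesis chi_schwartz : schwartz chi.
Hypothesis chi_ge0 : forall z, 0 <= chi z.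

(** Since (1 + X)^2 <= 2 (1 + X^2), the product (1 + X)^2 (1 + Y)^2 is controlled by the four
    monomials with exponents 0 or 2, hence by four seminorms of chi itself. *)
Lemma schwartz_decay : exists C, forall z, chi z <= C * (decay z.1 * decay z.2).
Proof.
have [_ H] := chi_schwartz [::].
have [C00 h00] := H 0%N 0%N; have [C02 h02] := H 0%N 2%N.
have [C20 h20] := H 2%N 0%N; have [C22 h22] := H 2%N 2%N.
exists (4 * (C00 + C02 + C20 + C22)) => -[x y].
have := h00 (x, y); have := h02 (x, y); have := h20 (x, y); have := h22 (x, y).
rewrite /= !expr0 !mul1r ?mulr1 !normrM (ger0_norm (chi_ge0 _)).
set c := chi (x, y) => H22 H20 H02 H00.
have c0 : 0 <= c := chi_ge0 _.
rewrite /decay -invfM ler_pdivlMr; last first.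
  by rewrite mulr_gt0// exprn_gt0// ltr_wpDr.
have X0 := normr_ge0 x; have Y0 := normr_ge0 y.
move: X0 Y0 H22 H20 H02 H00; set X := `|x|; set Y := `|y| => X0 Y0 H22 H20 H02 H00.
have sq (Z : R) : (1 + Z) ^+ 2 <= 2 * (1 + Z ^+ 2).
  by rewrite -subr_ge0 [leRHS](_ : _ = (1 - Z) ^+ 2) ?sqr_ge0//; ring.
apply: (@le_trans _ _ (c * (2 * (1 + X ^+ 2) * (2 * (1 + Y ^+ 2))))).
  by rewrite ler_wpM2l// ler_pM ?sqr_ge0.
rewrite (_ : c * _ = 4 * (c + Y ^+ 2 * c + X ^+ 2 * c + X ^+ 2 * Y ^+ 2 * c)); last by ring.
by rewrite ler_wpM2l//; lra.
Qed.

Lemma schwartz_box : (exists z, chi z != 0) -> exists x0 y0 c r : R,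
  [/\ 0 < c, 0 < r & forall x y, `|x - x0| <= r -> `|y - y0| <= r -> c <= chi (x, y)].
Proof.
move=> [[x0 y0] z0]; have cz : 0 < chi (x0, y0) by rewrite lt_neqAle eq_sym z0/=.
have [/(_ (x0, y0))/differentiable_continuous chic _] := chi_schwartz [::].
have c2 : chi (x0, y0) / 2 < chi (x0, y0) by lra.
have : \forall t \near (x0, y0), chi (x0, y0) / 2 < chi t.
  exact: (@cvgr_gt _ _ _ _ chi _ chic).
move=> /nbhs_ballP[r /= r0 rchi].
(* Halving the radius puts the closed box inside the open ball. *)
exists x0, y0, (chi (x0, y0) / 2), (r / 2).
split; [lra|lra|move=> x y xr yr; apply/ltW/rchi].
by split; rewrite /ball/= distrC; lra.
Qed.

End Schwartz.

(** The point tau*(a, b) is the orthogonal projection of (q, p) on the line through (a, b). Both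
    components of the residual are multiples of q theta - p, with coefficients of modulus at most
    1. *)
Lemma tau_star_dist (R : realType) (a b : R) (n : nat) : 0 < a -> 0 < b ->
  irrational (b / a) ->
  `|tau_star a b n * a - (cf_q (b / a) n)%:~R| <= (cf_q (b / a) n)%:~R^-1 /\
  `|tau_star a b n * b - (cf_p (b / a) n)%:~R| <= (cf_q (b / a) n)%:~R^-1.
Proof.
move=> a0 b0 irr; have := convergent_dist n irr; rewrite /tau_star.
set q := (cf_q _ _)%:~R; set p := (cf_p _ _)%:~R => h.
have D0 : 0 < a ^+ 2 + b ^+ 2 by nra.
split.
  rewrite [X in `|X|](_ : _ = - (a * b / (a ^+ 2 + b ^+ 2) * (b / a * q - p))); last first.
    by field; rewrite !gt_eqF.
  apply: le_trans h; rewrite normrN normrM ler_piMl// ger0_norm; last first.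
    by rewrite divr_ge0 ?mulr_ge0 ?ltW.
  by rewrite ler_pdivrMr// mul1r; nra.
rewrite [X in `|X|](_ : _ = a ^+ 2 / (a ^+ 2 + b ^+ 2) * (b / a * q - p)); last first.
  by field; rewrite !gt_eqF.
apply: le_trans h; rewrite normrM ler_piMl// ger0_norm; last first.
  by rewrite divr_ge0 ?sqr_ge0 ?ltW.
by rewrite ler_pdivrMr// mul1r; nra.
Qed.

(** The periods may be negative while [a] and [b] use their absolute values. The sign is an integer
    so that it can be absorbed into the integer part of the phase. *)
Lemma inv_sign_norm (R : realType) (T : R) : T != 0 ->
  exists2 s : int, `|s%:~R : R| = 1 & T^-1 = s%:~R * (1 / `|T|).
Proof.
move=> T0; exists (sgz T); first by rewrite -sgrEz normr_sg T0.
rewrite -sgrEz mul1r -normfV -sgrV -numEsg//.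
Qed.

Lemma phase_near_1 (R : realType) (T1 T2 : R) (n : nat) (k l : int) :
  T1 != 0 -> T2 != 0 ->
  let a := 1 / `|T1| in let b := 1 / `|T2| in irrational (b / a) ->
  Normc.normc (expi (- 2 * pi * tau_star a b n * (k%:~R / T1 + l%:~R / T2)) - 1)
    <= 4 * pi / (cf_q (b / a) n)%:~R * (`|k%:~R| + `|l%:~R|).
Proof.
move=> T10 T20 a b irr.
have a0 : 0 < a by rewrite divr_gt0// normr_gt0.
have b0 : 0 < b by rewrite divr_gt0// normr_gt0.
have [s1 s1n ->] := inv_sign_norm T10; have [s2 s2n ->] := inv_sign_norm T20.
rewrite -/a -/b; have [] := tau_star_dist n a0 b0 irr.
set t := tau_star a b n; set q := cf_q _ _; set p := cf_p _ _ => hq hp.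
set e1 := t * a - q%:~R in hq; set e2 := t * b - p%:~R in hp.
(* Split t a = q + e1 and t b = p + e2: the q and p parts contribute integer multiples of 2 pi, and
   only the errors remain. *)
have -> : - 2 * pi * t * (k%:~R * (s1%:~R * a) + l%:~R * (s2%:~R * b)) =
    (- 2 * pi * (k%:~R * s1%:~R * e1 + l%:~R * s2%:~R * e2))
      + 2 * pi * (- (k * s1 * q + l * s2 * p))%:~R.
  by rewrite /e1 /e2 rmorphN/= !rmorphD/= !rmorphM/=; ring.
rewrite expiD_int (le_trans (normc_expi_sub1 _))//.
have pi0 := pi_ge0 R.
rewrite !normrM normrN (ger0_norm pi0) normr_nat.
rewrite [leRHS](_ : _ = 2 * (2 * pi * ((`|k%:~R| + `|l%:~R|) * q%:~R^-1))); last by ring.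
rewrite ler_wpM2l// ler_wpM2l ?mulr_ge0// (le_trans (ler_normD _ _))//.
rewrite !normrM s1n s2n !mulr1 mulrDl; apply: lerD; exact: ler_wpM2l.
Qed.

(** Being nearer to level n than to level n + 1, E lies below their midpoint omega h (n + 1). *)
Lemma nearest_level_gt (R : realType) (omega E h : R) (n : nat) :
  0 < omega * h -> unique_nearest omega E h n -> E - omega * h < omega * h * n%:R.
Proof.
move=> oh /(_ n.+1 (n_Sn n \o esym)); rewrite /level.
set w := omega * h in oh *; rewrite -[n.+1]addn1 PoszD rmorphD/= -!pmulrn.
rewrite -ltr_sqr ?nnegrE// !real_normK ?num_real//; nra.
Qed.

(** The mesh is omega h^(1 - delta), which tends to 0. The index n is at least about E / (omega h),
    while the window sits at distance O(h^delta / (omega h)) from it, so it stays among nonnegative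
    indices. *)
Lemma near_scale (R : realType) (omega E delta z r : R) :
  0 < omega -> 0 < E -> 0 < r -> 0 < delta < 1 ->
  \forall h \near (0 : R)^'+, let eps := omega * h / h `^ delta in
    [/\ eps <= 1, eps <= r & forall n, unique_nearest omega E h n ->
      0 <= n%:R + (z - r) / eps].
Proof.
move=> o0 E0 r0 /andP[d0 d1].
have d1' : 0 < 1 - delta by lra.
pose m := Num.min 1 r / omega.
have m0 : 0 < m by rewrite divr_gt0// lt_min ltr01.
(* Half of E pays for the window, through h^delta (|z| + r) <= E/2; the other half pays for the
   spacing omega h. *)
pose e := E / 2 / (`|z| + r).
have zr0 : 0 < `|z| + r by rewrite ltr_wpDl.
have e0 : 0 < e by rewrite !divr_gt0.
near=> h.
have h0 : 0 < h by near: h; exact: nbhs_right_gt.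
have hm : h `^ (1 - delta) <= m.
  rewrite ltW//; near: h; apply: cvgr_lt m0; exact: powR_cvg0.
have he : h `^ delta <= e.
  rewrite ltW//; near: h; apply: cvgr_lt e0; exact: powR_cvg0.
have hE : h < E / 2 / omega.
  by near: h; apply: nbhs_right_lt; rewrite !divr_gt0.
have hd0 : 0 < h `^ delta by rewrite powR_gt0.
have epsE : omega * h / h `^ delta = omega * h `^ (1 - delta).
  by rewrite -mulrA powRB ?powRr1 ?ltW// ?gt_eqF//; apply/implyP.
have eps1 : omega * h / h `^ delta <= Num.min 1 r.
  by rewrite epsE mulrC -ler_pdivlMr.
move: eps1; rewrite le_min => /andP[eps1 epsr]; split => // n near_n.
have oh : 0 < omega * h by rewrite mulr_gt0.
have := nearest_level_gt oh near_n.
have oh2 : omega * h < E / 2 by rewrite mulrC -ltr_pdivlMr.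
have hz : h `^ delta * (`|z| + r) <= E / 2 by rewrite -ler_pdivlMr.
set w := h `^ delta in hd0 hz * => hn.
rewrite [leRHS](_ : _ = (omega * h * n%:R + (z - r) * w) / (omega * h)); last first.
  by field; rewrite !gt_eqF.
rewrite divr_ge0 ?(ltW oh)//.
have wz : 0 <= w * (`|z| + z).
  by rewrite mulr_ge0 ?(ltW hd0)//; have := ler_norm (- z); rewrite normrN; lra.
by move: (omega * h) oh2 hn wz hz => v; lra.
Unshelve. all: end_near. Qed.

(** * Assembly of the estimate *)

Theorem theorem3p35 (R : realType) (omega1 omega2 : R) (F : {poly {poly R}})
    (E1 E2 delta1 delta1' delta2 delta2' : R) (chi : R * R -> R) (mu : R)
    (omega1_gt0 : 0 < omega1) (omega2_gt0 : 0 < omega2)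
    (E1_bounds : 0 < E1 <= 1) (E2_bounds : 0 < E2 <= 1)
    (delta1_gt0 : 0 < delta1) (delta1_lt : delta1 < delta1')
    (delta1'_lt1 : delta1' < 1)
    (delta2_gt0 : 0 < delta2) (delta2_lt : delta2 < delta2')
    (delta2'_lt1 : delta2' < 1)
    (chi_schwartz : schwartz chi)
    (chi_ge0 : forall z, 0 <= chi z) (chi_neq0 : exists z, chi z != 0)
    (dXF_neq0 : (dX F).[E1, E2] != 0) (dYF_neq0 : (dY F).[E1, E2] != 0)
    (mu_gt0 : 0 < mu) :
  let T1 := Tcl1 omega1 F E1 E2 in
  let T2 := Tcl2 omega2 F E1 E2 in
  let a := 1 / `|T1| in
  let b := 1 / `|T2| in
  let theta := b / a in
  irrational theta ->
  exists C : R, \forall h \near (0 : R)^'+, forall n0 m0 : nat,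
    unique_nearest omega1 E1 h n0 -> unique_nearest omega2 E2 h m0 ->
    let A := Aset theta delta1 delta2 delta1' delta2' mu h in
    A !=set0 ->
    (ereal_sup [set (Normc.normc
         (a1 chi omega1 omega2 delta1' delta2' T1 T2 h n0 m0
            (tau_star a b n) - 1))%:E | n in [set n : nat | A (cf_q theta n)]]
     <= (C * h `^ mu)%:E)%E.
Proof.
move=> T1 T2 a b theta irr.
have pi2_neq0 : 2 * pi != 0 :> R by rewrite gt_eqF// mulr_gt0// pi_gt0.
have T10 : T1 != 0.
  by apply: mulf_neq0 => //; rewrite invr_eq0 mulf_neq0// gt_eqF.
have T20 : T2 != 0.
  by apply: mulf_neq0 => //; rewrite invr_eq0 mulf_neq0// gt_eqF.
have [C chiC] := schwartz_decay chi_schwartz chi_ge0.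
have [x0 [y0 [c [r [c0 r0 box]]]]] := schwartz_box chi_schwartz chi_ge0 chi_neq0.
have [/andP[E10 _] /andP[E20 _]] := (E1_bounds, E2_bounds).
have cr0 : 0 < (c * r) ^+ 2 by rewrite exprn_gt0// mulr_gt0.
(* Ratio of the constant in the moment bound to the one in the lower bound on the mass; the factors
   1 / (eps1 eps2) cancel. *)
pose K := 16 * C ^+ 2 / (c * r) ^+ 2.
have K0 : 0 <= K by apply: divr_ge0; [apply: mulr_ge0 => //; exact: sqr_ge0|exact: ltW].
exists (4 * pi * K * (omega1^-1 + omega2^-1)).
near=> h; move=> n0 m0 near_n0 near_m0 _.
have h0 : 0 < h by near: h; exact: nbhs_right_gt.
have h1 : h <= 1 by near: h; exact: nbhs_right_le.
have [e11 e1r /(_ n0 near_n0) n0_large] : let eps := omega1 * h / h `^ delta1' in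
    [/\ eps <= 1, eps <= r & forall n, unique_nearest omega1 E1 h n ->
      0 <= n%:R + (x0 - r) / eps].
  by near: h; apply: near_scale => //; rewrite (lt_trans delta1_gt0).
have [e21 e2r /(_ m0 near_m0) m0_large] : let eps := omega2 * h / h `^ delta2' in
    [/\ eps <= 1, eps <= r & forall n, unique_nearest omega2 E2 h n ->
      0 <= n%:R + (y0 - r) / eps].
  by near: h; apply: near_scale => //; rewrite (lt_trans delta2_gt0).
set eps1 := omega1 * h / h `^ delta1' in e11 e1r n0_large *.
set eps2 := omega2 * h / h `^ delta2' in e21 e2r m0_large *.
have eps1_gt0 : 0 < eps1 by rewrite divr_gt0 ?mulr_gt0 ?powR_gt0.
have eps2_gt0 : 0 < eps2 by rewrite divr_gt0 ?mulr_gt0 ?powR_gt0.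
apply: ge_ereal_sup => _ [n /= [_ /andP[qge _]] <-]; rewrite lee_fin.
set q := (cf_q theta n)%:~R in qge.
pose u (i : nat * nat) :=
  chi (eps1 * (i.1%:R - n0%:R), eps2 * (i.2%:R - m0%:R)) ^+ 2.
pose S := sum (u : nat * nat -> R^o).
have uN := partial_sum_sqr_profile_le chi_ge0 chiC n0 m0 eps1_gt0 eps2_gt0 e11 e21.
have uM := partial_sum_moment_le chi_ge0 chiC n0 m0 eps1_gt0 eps2_gt0 e11 e21.
have uS := sum_sqr_profile_ge chi_ge0 chiC c0 r0 box eps1_gt0 eps2_gt0 e11 e21
  e1r e2r n0_large m0_large.
have S0 : 0 < S by apply: lt_le_trans uS; rewrite divr_gt0// mulr_gt0.
(* The shifts 1/2 cancel in differences of levels, leaving eps (n - n0). *)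
have profileE (i : nat * nat) :
    profile chi omega1 omega2 delta1' delta2' h n0 m0 (i.1 : int) (i.2 : int) ^+ 2 = u i.
  rewrite /u /profile /level /eps1 /eps2; congr (chi (_, _) ^+ 2);
    by field; rewrite gt_eqF ?powR_gt0.
pose phi (i : nat * nat) : R :=
  - 2 * pi * tau_star a b n * ((i.1%:R - n0%:R) / T1 + (i.2%:R - m0%:R) / T2).
have -> : a1 chi omega1 omega2 delta1' delta2' T1 T2 h n0 m0 (tau_star a b n) =
    sum (fun i => (u i / S)%:C%C * expi (phi i) : R[i]^o).
  rewrite /a1 (eq_sum (V := R[i]^o) (y := fun i => (u i / S)%:C%C * expi (phi i)))// => i.
  congr (_%:C%C * _).
  rewrite /coef /l2norm real_normK ?num_real// exprMn profileE.
  rewrite (eq_sum (V := R^o) (y := u)); last first.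
    by move=> j; rewrite real_normK ?num_real// profileE.
  by rewrite exprVn sqr_sqrtr ?(ltW S0)// mulrC.
have q0 : 0 < q by apply: lt_le_trans qge; rewrite powR_gt0.
apply: (@le_trans _ _ (4 * pi / q * (K * (eps1^-1 + eps2^-1)))); last first.
  (* As h <= 1, each 1/eps_i is at most omega_i^-1 h^(m - 1). *)
  set m := Num.min delta1' delta2' in qge.
  have epsV omega delta' : 0 < omega -> m <= delta' ->
      (omega * h / h `^ delta')^-1 <= omega^-1 * h `^ (m - 1).
    move=> omega0 mdelta.
    rewrite invf_div [leLHS](_ : _ = omega^-1 * (h `^ delta' / h)); last first.
      by field; rewrite !gt_eqF.
    rewrite ler_wpM2l ?invr_ge0 ?(ltW omega0)// powRB ?powRr1 ?(ltW h0)//; last first.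
      by apply/implyP => _; rewrite gt_eqF.
    by rewrite ler_pM2r ?invr_gt0// ger_powR// h0.
  (* This is where the lower bound q >= h^(m - 1 - mu) from [Aset] enters. *)
  have hq : h `^ (m - 1) / q <= h `^ mu.
    rewrite ler_pdivrMr// (_ : m - 1 = mu + (m - 1 - mu)); last by ring.
    by rewrite powRD ?ler_wpM2l ?powR_ge0//; apply/implyP => _; rewrite gt_eqF.
  have h1V : eps1^-1 <= omega1^-1 * h `^ (m - 1).
    by apply: epsV => //; rewrite ge_min lexx.
  have h2V : eps2^-1 <= omega2^-1 * h `^ (m - 1).
    by apply: epsV => //; rewrite ge_min lexx orbT.
  apply: (@le_trans _ _ (4 * pi * K * (omega1^-1 + omega2^-1) * (h `^ (m - 1) / q))).
    rewrite [leRHS](_ : _ = 4 * pi / q *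
      (K * (omega1^-1 * h `^ (m - 1) + omega2^-1 * h `^ (m - 1)))); last by ring.
    rewrite ler_wpM2l ?divr_ge0 ?mulr_ge0 ?pi_ge0 ?(ltW q0)//.
    by rewrite ler_wpM2l// lerD.
  have omegaV : 0 <= omega1^-1 + omega2^-1 by rewrite addr_ge0// invr_ge0 ltW.
  by apply: ler_wpM2l => //; do 3!apply: mulr_ge0 => //; exact: pi_ge0.
apply: (@normc_sum_phases_sub1 _ _ _ (fun i : nat * nat =>
  4 * pi / q * (`|i.1%:R - n0%:R| + `|i.2%:R - m0%:R|)) _ _ _ _ uN) => //.
- by move=> i; rewrite sqr_ge0.
- move=> i; have := phase_near_1 n (i.1%:Z - n0%:Z) (i.2%:Z - m0%:Z) T10 T20 irr.
  by rewrite !rmorphB/= -!pmulrn.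
move=> B; rewrite -[leRHS]mulrA.
apply: (@le_trans _ _ (4 * pi / q *
    partial_sum (fun i => u i * (`|i.1%:R - n0%:R| + `|i.2%:R - m0%:R|)) B)).
  by rewrite /partial_sum mulr_sumr; apply: ler_sum => i _; rewrite mulrCA.
rewrite ler_wpM2l ?divr_ge0 ?mulr_ge0 ?pi_ge0 ?(ltW q0)//.
apply: le_trans (uM B) _; rewrite [leRHS]mulrAC; apply: ler_wpM2r.
  by rewrite addr_ge0// invr_ge0 ltW.
(* The lower bound [uS] on the mass turns 1 / (eps1 eps2) into a multiple of S. *)
rewrite /K [leLHS](_ : _ = 16 * C ^+ 2 / (c * r) ^+ 2 * ((c * r) ^+ 2 / (eps1 * eps2))).
  by rewrite ler_wpM2l.
by field; rewrite !gt_eqF.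
Unshelve. all: end_near. Qed.
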